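(* Let $\mathcal{R}=R_1\times R_2\times\dots\times R_m$ be a commutative finite principal ideal ring, where $R_1,R_2,\dots,R_m$ are commutative finite chain rings, and let $n$ be a positive integer. Let $r\in\mathcal{R}$ and, for $1\le i\le m$, let $\phi_i:\mathcal{R}\to R_i$ be the projection $\phi_i((r_1,r_2,\dots,r_m))=r_i$. Then \[d_n(\mathcal{R},r)=d_n(R_1,\phi_1(r))\,d_n(R_2,\phi_2(r))\cdots d_n(R_m,\phi_m(r))\] and \[c_n(\mathcal{R},r)=c_n(R_1,\phi_1(r))\,c_n(R_2,\phi_2(r))\cdots c_n(R_m,\phi_m(r)).\]
   Context: A commutative finite chain ring (CFCR) is a finite commutative ring with identity $1\neq 0$ whose ideals are linearly ordered by inclusion. A commutative finite principal ideal ring (CFPIR) is a finite commutative ring with identity $1\neq0$ in which every ideal is principal; every CFPIR is a direct product of CFCRs. For a commutative ring $S$, $n\in\mathbb{N}$ and $a\in S$: $d_n(S,a)$ denotes the number of $n\times n$ diagonal matrices over $S$ with determinant $a$; $c_n(S,a)$ denotes the number of $n\times n$ circulant matrices over $S$ with determinant $a$, where a circulant matrix $\mathrm{cir}(a_1,\dots,a_n)$ has first row $(a_1,a_2,\dots,a_n)$, $a_i\in S$, and each subsequent row is the right cyclic shift of the previous row. *)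

(* Defs.v *)
From HB Require Import structures.
From mathcomp Require Import all_boot all_algebra.
Set Implicit Arguments.
Unset Strict Implicit.
Unset Printing Implicit Defensive.
Import GRing.Theory.
Local Open Scope ring_scope.

(* The library's finComPzRingType allows the zero ring; the condition 1 != 0
   is therefore part of is_cfcr and is_cfpir below. *)

(* The library's idealr_closed only covers proper ideals, whereas the unit
   ideal must be allowed here. *)
Definition is_ideal (S : finComPzRingType) (I : {set S}) : Prop :=
  zmod_closed I /\ forall a x : S, x \in I -> a * x \in I.

Definition principal_ideal (S : finComPzRingType) (x : S) : {set S} :=
  [set a * x | a : S].

Definition is_cfcr (S : finComPzRingType) : Prop :=
  (1 : S) != 0 /\
  forall I J : {set S}, is_ideal I -> is_ideal J -> I \subset J \/ J \subset I.

Definition is_cfpir (S : finComPzRingType) : Prop :=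
  (1 : S) != 0 /\
  forall I : {set S}, is_ideal I -> exists x : S, I = principal_ideal x.

Definition prod_ring (m : nat) (R : 'I_m -> finComPzRingType) : Type :=
  {dffun forall i : 'I_m, R i}.

Definition proj (m : nat) (R : 'I_m -> finComPzRingType) (i : 'I_m)
  (r : prod_ring R) : R i := (r : {dffun forall i : 'I_m, R i}) i.

Section ProdRing.
Variables (m : nat) (R : 'I_m -> finComPzRingType).

Definition tup (f : forall i, R i) : prod_ring R :=
  [ffun i => f i] : {dffun forall i : 'I_m, R i}.

Lemma proj_tup f i : proj i (tup f) = f i.
Proof. by rewrite /proj ffunE. Qed.

Lemma prod_ringP (r s : prod_ring R) :
  (forall i, proj i r = proj i s) <-> r = s.
Proof. exact: ffunP. Qed.

Definition prod_zero := tup (fun=> 0).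
Definition prod_one := tup (fun=> 1).
Definition prod_opp r := tup (fun i => - proj i r).
Definition prod_add r s := tup (fun i => proj i r + proj i s).
Definition prod_mul r s := tup (fun i => proj i r * proj i s).

Fact prod_addA : associative prod_add.
Proof. by move=> r s t; apply/prod_ringP=> i; rewrite !proj_tup addrA. Qed.
Fact prod_addC : commutative prod_add.
Proof. by move=> r s; apply/prod_ringP=> i; rewrite !proj_tup addrC. Qed.
Fact prod_add0 : left_id prod_zero prod_add.
Proof. by move=> r; apply/prod_ringP=> i; rewrite !proj_tup add0r. Qed.
Fact prod_addN : left_inverse prod_zero prod_opp prod_add.
Proof. by move=> r; apply/prod_ringP=> i; rewrite !proj_tup addNr. Qed.
Fact prod_mulA : associative prod_mul.
Proof. by move=> r s t; apply/prod_ringP=> i; rewrite !proj_tup mulrA. Qed.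
Fact prod_mulC : commutative prod_mul.
Proof. by move=> r s; apply/prod_ringP=> i; rewrite !proj_tup mulrC. Qed.
Fact prod_mul1 : left_id prod_one prod_mul.
Proof. by move=> r; apply/prod_ringP=> i; rewrite !proj_tup mul1r. Qed.
Fact prod_mulDl : left_distributive prod_mul prod_add.
Proof. by move=> r s t; apply/prod_ringP=> i; rewrite !proj_tup mulrDl. Qed.
Fact prod_mulr1 : right_id prod_one prod_mul.
Proof. by move=> r; rewrite prod_mulC prod_mul1. Qed.
Fact prod_mulDr : right_distributive prod_mul prod_add.
Proof. by move=> r s t; rewrite !(prod_mulC r) prod_mulDl. Qed.

HB.instance Definition _ :=
  Finite.copy (prod_ring R) {dffun forall i : 'I_m, R i}.
HB.instance Definition _ := GRing.isZmodule.Build (prod_ring R)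
  prod_addA prod_addC prod_add0 prod_addN.
HB.instance Definition _ := GRing.Zmodule_isPzRing.Build (prod_ring R)
  prod_mulA prod_mul1 prod_mulr1 prod_mulDl prod_mulDr.
HB.instance Definition _ :=
  GRing.PzSemiRing_hasCommutativeMul.Build (prod_ring R) prod_mulC.

End ProdRing.

Definition num_diag (n : nat) (S : finComPzRingType) (a : S) : nat :=
  #|[set A : 'M[S]_n | is_diag_mx A && (\det A == a)]|.

(* The entry of index 0 of the shifted row is the last entry of v. *)
Definition right_shift (T : Type) (n : nat) (v : 'rV[T]_n) : 'rV[T]_n :=
  \row_j v 0 (ord_pred j).

Definition cir (T : Type) (n : nat) (v : 'rV[T]_n) : 'M[T]_n :=
  \matrix_(i < n) iter i (@right_shift T n) v.

Definition num_circ (n : nat) (S : finComPzRingType) (a : S) : nat :=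
  #|[set A in [set cir v | v : 'rV[S]_n] | \det A == a]|.

(* A product of at least one chain ring is principal, so requiring both in a
   statement is not a restriction. *)
Lemma prod_ring_cfpir (m : nat) (R : 'I_m -> finComPzRingType) :
  (0 < m)%N -> (forall i, is_cfcr (R i)) -> is_cfpir (prod_ring R).
Proof.
move=> m_gt0 cR; split.
  apply/eqP=> /(congr1 (@proj m R (Ordinal m_gt0))).
  by rewrite !proj_tup => /eqP; apply/negP; case: (cR (Ordinal m_gt0)).
move=> I [[I0 IB] IM].
have ID r s : r \in I -> s \in I -> r + s \in I.
  by move=> Ir Is; rewrite -[s]opprK IB // -sub0r IB.
have pri i (x : R i) : is_ideal (principal_ideal x).
  split; first split.
  - by apply/imsetP; exists 0; rewrite ?mul0r.
  - move=> _ _ /imsetP[a _ ->] /imsetP[b _ ->].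
    by apply/imsetP; exists (a - b); rewrite ?mulrBl.
  - move=> b _ /imsetP[a _ ->].
    by apply/imsetP; exists (b * a); rewrite ?mulrA.
have ex i : exists r, (r \in I) && [forall s in I,
    principal_ideal (proj i s) \subset principal_ideal (proj i r)].
  pose f (r : prod_ring R) := #|principal_ideal (proj i r)|.
  have [r Ir rmax] := @arg_maxnP _ 0 (mem I) f I0.
  exists r; apply/andP; split=> //; apply/forall_inP => s Is.
  have [_ lin] := cR i.
  have [//|sub] := lin _ _ (pri i (proj i s)) (pri i (proj i r)).
  by have /eqP -> : principal_ideal (proj i r) == principal_ideal (proj i s)
    by rewrite eqEcard sub; apply: rmax.
pose g i := xchoose (ex i).
have gI i : g i \in I by have /andP[] := xchooseP (ex i).
have gM i s : s \in I -> exists a, proj i s = a * proj i (g i).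
  have /andP[_ /forall_inP h] := xchooseP (ex i).
  move=> /h /subsetP/(_ (proj i s)); case/(_ _)/imsetP; last by move=> a; exists a.
  by apply/imsetP; exists 1; rewrite ?mul1r.
pose e i : prod_ring R := tup (fun j => (j == i)%:R).
have proj_sum i (F : 'I_m -> prod_ring R) :
    proj i (\sum_j F j) = \sum_j proj i (F j).
  elim/big_rec2: _ => [|j y r _ <-]; first exact: proj_tup.
  exact: proj_tup.
pose x := \sum_i e i * g i.
have px i : proj i x = proj i (g i).
  rewrite proj_sum (bigD1 i) //= big1 => [|j ne]; rewrite !proj_tup ?eqxx.
    by rewrite mul1r addr0.
  by rewrite eq_sym (negPf ne) mul0r.
exists x; apply/setP=> s; apply/idP/imsetP=> [Is | [a _ ->]].
  have ch i : exists a, proj i s == a * proj i (g i).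
    by have [a ->] := gM i s Is; exists a.
  exists (tup (fun i => xchoose (ch i))) => //.
  apply/prod_ringP=> i; rewrite !proj_tup px.
  exact/eqP/(xchooseP (ch i)).
apply: (IM); rewrite /x; elim/big_rec: _ => // i r _ Ir.
by apply: ID => //; apply: IM.
Qed.

(* Main.v *)
(* The projections R -> R_i are ring morphisms and are jointly bijective, so
   a matrix over the product is the same thing as a family of matrices over the
   factors; its determinant, its being diagonal and its being circulant are all
   read off componentwise. *)
Require Import Defs.
From HB Require Import structures.
From mathcomp Require Import all_boot all_algebra.
Import GRing.Theory.
Local Open Scope ring_scope.

Set Implicit Arguments.
Unset Strict Implicit.
Unset Printing Implicit Defensive.

Lemma is_diag_map_mx (aR rR : nmodType) (f : {additive aR -> rR}) (k n : nat)
  (A : 'M[aR]_(k, n)) : is_diag_mx A -> is_diag_mx (map_mx f A).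
Proof.
move/is_diag_mxP=> dA; apply/is_diag_mxP=> i j /dA.
by rewrite mxE => ->; rewrite raddf0.
Qed.

(** [right_shift] only relabels positions, so it commutes with any entrywise map. *)
Lemma map_cir (T U : Type) (f : T -> U) (n : nat) (v : 'rV[T]_n) :
  map_mx f (cir v) = cir (map_mx f v).
Proof.
apply/matrixP=> i j; rewrite !mxE.
(* The column [j] stays general because one more shift reads the previous row at [ord_pred j]. *)
elim: (nat_of_ord i) j => [|k IHk] j; rewrite /= !mxE //.
Qed.

Section ProdMatrix.
Variables (m : nat) (R : 'I_m -> finComPzRingType).

Section Morphism.
Variable i : 'I_m.

Fact proj_is_zmod_morphism : zmod_morphism (@proj m R i).
Proof. by move=> r s; rewrite !proj_tup. Qed.

Fact proj_is_monoid_morphism : monoid_morphism (@proj m R i).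
Proof. by split=> [|r s]; rewrite proj_tup. Qed.

HB.instance Definition _ :=
  GRing.isZmodMorphism.Build (prod_ring R) (R i) (@proj m R i)
    proj_is_zmod_morphism.
HB.instance Definition _ :=
  GRing.isMonoidMorphism.Build (prod_ring R) (R i) (@proj m R i)
    proj_is_monoid_morphism.
End Morphism.

Lemma prod_mxP (k n : nat) (A B : 'M[prod_ring R]_(k, n)) :
  (forall i, map_mx (proj i) A = map_mx (proj i) B) <-> A = B.
Proof.
split=> [eqAB | -> //]; apply/matrixP=> a b; apply/prod_ringP=> i.
by have /matrixP/(_ a b) := eqAB i; rewrite !mxE.
Qed.

(** Inverse of the map sending a matrix to the family of its projections. *)
Definition tup_mx (k n : nat) (F : forall i, 'M[R i]_(k, n)) :
  'M[prod_ring R]_(k, n) := \matrix_(a, b) tup (fun i => F i a b).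

Lemma map_tup_mx (k n : nat) (F : forall i, 'M[R i]_(k, n)) i :
  map_mx (proj i) (tup_mx F) = F i.
Proof. by apply/matrixP=> a b; rewrite !mxE proj_tup. Qed.

(** Taking all projections at once is a bijection from [X] onto the Cartesian product of the [Y i],
    whose cardinality is the product of theirs. *)
Lemma card_prod_mx (k n : nat) (X : {set 'M[prod_ring R]_(k, n)})
    (Y : forall i, {set 'M[R i]_(k, n)}) :
    (forall A, A \in X <-> forall i, map_mx (proj i) A \in Y i) ->
  #|X| = (\prod_(i < m) #|Y i|)%N.
Proof.
move=> XY; rewrite -cardsXn.
pose f A : {dffun forall i, 'M[R i]_(k, n)} := [ffun i => map_mx (proj i) A].
have f_inj : injective f.
  move=> A B /ffunP eqf; apply/prod_mxP=> i.
  by have := eqf i; rewrite !ffunE.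
(* By injectivity it suffices that the image of [X] is the whole product; [tup_mx F] supplies the
   preimage of [F]. *)
rewrite -(card_imset X f_inj); apply: eq_card => F.
apply/imsetP/setXnP => [[A /XY XA ->] i | YF]; first by rewrite ffunE; apply: XA.
exists (tup_mx F); first by apply/XY=> i; rewrite map_tup_mx; apply: YF.
by apply/ffunP=> i; rewrite ffunE map_tup_mx.
Qed.

(** Determinants commute with ring morphisms, and the projections jointly separate elements. *)
Lemma det_prod_mxP (n : nat) (A : 'M[prod_ring R]_n) (r : prod_ring R) :
  \det A = r <-> forall i, \det (map_mx (proj i) A) = proj i r.
Proof.
split=> [<- i | detA]; first exact: det_map_mx.
by apply/prod_ringP=> i; rewrite -detA det_map_mx.
Qed.

Lemma is_diag_prod_mxP (k n : nat) (A : 'M[prod_ring R]_(k, n)) :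
  is_diag_mx A <-> forall i, is_diag_mx (map_mx (proj i) A).
Proof.
split=> [dA i | dA]; first exact: is_diag_map_mx.
apply/is_diag_mxP=> a b neq_ab; apply/prod_ringP=> i.
by have /is_diag_mxP/(_ a b neq_ab) := dA i; rewrite mxE => ->; rewrite raddf0.
Qed.

Lemma circ_prod_mxP (n : nat) (A : 'M[prod_ring R]_n) :
  A \in [set cir v | v : 'rV_n] <->
  forall i, map_mx (proj i) A \in [set cir v | v : 'rV_n].
Proof.
split=> [/imsetP[v _ ->] i | cA].
  by rewrite map_cir; apply: imset_f.
(* The boolean equality lets [xchoose] pick a first row in each factor; these rows are then glued
   into one row over the product. *)
have ex i : exists v, map_mx (proj i) A == cir v.
  by have /imsetP[v _ ->] := cA i; exists v.
apply/imsetP; exists (tup_mx (fun i => xchoose (ex i))) => //.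
by apply/prod_mxP=> i; rewrite map_cir map_tup_mx; apply/eqP/(xchooseP (ex i)).
Qed.

(** Common form of both counts: [P] stands for being diagonal or being circulant. *)
Lemma card_det_prod_mx (n : nat) (r : prod_ring R)
    (P : pred 'M[prod_ring R]_n) (Q : forall i, pred 'M[R i]_n) :
    (forall A, P A <-> forall i, Q i (map_mx (proj i) A)) ->
  #|[set A | P A && (\det A == r)]| =
    (\prod_(i < m) #|[set A | Q i A && (\det A == proj i r)]|)%N.
Proof.
move=> PQ; apply: card_prod_mx => A; rewrite inE; split.
  by case/andP=> /PQ QA /eqP/det_prod_mxP detA i; rewrite inE QA detA /=.
move=> QA; apply/andP; split.
  by apply/PQ=> i; have := QA i; rewrite inE => /andP[].
by apply/eqP/det_prod_mxP=> i; have := QA i; rewrite inE => /andP[_ /eqP].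
Qed.

End ProdMatrix.

Theorem theorem5p1 (m : nat) (R : 'I_m -> finComPzRingType)
  (hR : forall i : 'I_m, is_cfcr (R i))
  (hprod : is_cfpir (prod_ring R))
  (n : nat) (hn : (0 < n)%N)
  (r : prod_ring R) :
  num_diag n r = (\prod_(i < m) num_diag n (proj i r))%N /\
  num_circ n r = (\prod_(i < m) num_circ n (proj i r))%N.
Proof.
split; apply: card_det_prod_mx => A.
  exact: is_diag_prod_mxP.
exact: circ_prod_mxP.
Qed.
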